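(* Let $\alpha\ge 3$ be finite, let $T$ be the set of all maps $\sigma:\alpha\to\alpha$, and let $\mathfrak{A}=\langle A,+,-,\mathsf{c}_{(\Gamma)},\mathsf{s}_{\sigma}\rangle_{\Gamma\subseteq\alpha,\ \sigma\in T}$ be an algebra with $+$ binary and $-$, all $\mathsf{c}_{(\Gamma)}$, all $\mathsf{s}_\sigma$ unary. Then $\mathfrak{A}\in\mathsf{RPA}_{\alpha}$ if and only if $\langle A,+,-,\mathsf{c}_{(\Gamma)}\rangle_{\Gamma\subseteq\alpha}\in\mathsf{Rdf}_{\alpha}$ and the following equations hold in $\mathfrak{A}$ for all $\Gamma\subseteq\alpha$ and $\sigma,\tau\in T$: \begin{align*} &\mathsf{s}_{\sigma}(x+y)=\mathsf{s}_{\sigma}(x)+\mathsf{s}_{\sigma}(y),\qquad \mathsf{s}_{\sigma}(-x)=-\mathsf{s}_{\sigma}(x),\\ &\mathsf{s}_{\sigma\circ\tau}(x)=\mathsf{s}_{\sigma}\mathsf{s}_{\tau}(x),\qquad \mathsf{s}_{\mathrm{Id}}(x)=x,\\ &\mathsf{s}_{\sigma}\mathsf{c}_{(\Gamma)}x=\mathsf{s}_{\tau}\mathsf{c}_{(\Gamma)}x\quad\text{if }\sigma,\tau\text{ differ only in }\Gamma\ (\text{i.e. }\sigma(i)=\tau(i)\text{ for all }i\in\alpha\setminus\Gamma),\\ &\mathsf{c}_{(\Gamma)}\mathsf{s}_{\sigma}(x)=\mathsf{s}_{\sigma}\mathsf{c}_{(\sigma^{-1}\Gamma)}x\quad\text{if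 }\sigma\text{ is one-one on }\sigma^{-1}\Gamma . \end{align*}
   Context: The ordinal $\alpha$ is identified with $\{0,\dots,\alpha-1\}$; ${}^{\alpha}U$ is the set of functions $s:\alpha\to U$; $\mathrm{Sb}(X)$ is the power set of $X$; $\circ$ is function composition, $(\sigma\circ\tau)(k)=\sigma(\tau(k))$; $\sigma^{-1}\Gamma=\{k<\alpha:\sigma(k)\in\Gamma\}$; $\mathrm{Id}$ is the identity map of $\alpha$. For a set $U$, $R\subseteq{}^{\alpha}U$, $\Gamma\subseteq\alpha$ and $\sigma\in T$ put $\mathsf{C}^U_{(\Gamma)}(R)=\{s\in{}^{\alpha}U: \text{there is } z\in R \text{ with } z(i)=s(i)\text{ for all } i\in\alpha\setminus\Gamma\}$ and $\mathsf{S}^U_{\sigma}(R)=\{s\in{}^{\alpha}U: s\circ\sigma\in R\}$. $\mathsf{RPA}_\alpha$ (representable polyadic algebras) is the class of all algebras isomorphic to a subalgebra of a direct product of algebras of the form $\langle \mathrm{Sb}({}^{\alpha}U),\cup,\setminus,\mathsf{C}^U_{(\Gamma)},\mathsf{S}^U_\sigma\rangle_{\Gamma\subseteq\alpha,\sigma\in T}$, $U$ a set (here $\setminus$ denotes complementation relative to ${}^\alpha U$). $\mathsf{Rdf}_\alpha$ (representable diagonal-free cylindric algebras) is the class of all algebras isomorphic to a subalgebra of a direct product of algebras of the form $\langle \mathrm{Sb}({}^{\alpha}U),\cup,\setminus,\mathsf{C}^U_{(\Gamma)}\rangle_{\Gamma\subseteq\alpha}$, $U$ a set. *)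

(* Defs.v *)
From mathcomp Require Import all_boot.
From mathcomp Require Import boolp classical_sets.

Set Implicit Arguments.
Unset Strict Implicit.
Unset Printing Implicit Defensive.

Local Open Scope classical_set_scope.

(* Algebras with one binary operation, one distinguished unary operation, and
   a further family of unary operations indexed by the symbols in J.  No
   axioms are imposed. *)
Record algebra (J : Type) := Algebra {
  carrier :> Type;
  plus : carrier -> carrier -> carrier;
  minus : carrier -> carrier;
  unop : J -> carrier -> carrier
}.

Section UniversalAlgebra.
Variable J : Type.
Implicit Types A B : algebra J.

Definition homomorphism A B (h : A -> B) : Prop :=
  [/\ forall x y, h (plus x y) = plus (h x) (h y),
      forall x, h (minus x) = minus (h x) &
      forall j x, h (unop j x) = unop j (h x)].

Definition isomorphic A B : Prop :=
  exists h : A -> B, bijective h /\ homomorphism h.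

Definition direct_product (I : Type) (F : I -> algebra J) : algebra J :=
  @Algebra J (forall i, F i)
    (fun x y i => plus (x i) (y i))
    (fun x i => minus (x i))
    (fun j x i => unop j (x i)).

Record subuniverse A (X : set A) : Prop := Subuniverse {
  sub_plus : forall x y, X x -> X y -> X (plus x y);
  sub_minus : forall x, X x -> X (minus x);
  sub_unop : forall j x, X x -> X (unop j x)
}.

Definition subalgebra A (X : set A) (cX : subuniverse X) : algebra J :=
  @Algebra J {x : A | X x}
    (fun x y => exist _ _ (sub_plus cX (proj2_sig x) (proj2_sig y)))
    (fun x => exist _ _ (sub_minus cX (proj2_sig x)))
    (fun j x => exist _ _ (sub_unop cX j (proj2_sig x))).

Definition isomorphic_to_subalgebra A B : Prop :=
  exists (X : set B) (cX : subuniverse X), isomorphic A (subalgebra cX).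

End UniversalAlgebra.

(* The finite ordinal alpha is 'I_n, and T is {ffun 'I_n -> 'I_n}. *)
Inductive polyadic_symbol (n : nat) : Type :=
| Cyl of {set 'I_n}
| Subst of {ffun 'I_n -> 'I_n}.

Notation polyadic_type_algebra n := (algebra (polyadic_symbol n)).
Notation df_type_algebra n := (algebra {set 'I_n}).

Definition cyl_op n (A : polyadic_type_algebra n) (G : {set 'I_n}) (x : A) : A :=
  unop (Cyl G) x.

Definition subst_op n (A : polyadic_type_algebra n) (sigma : {ffun 'I_n -> 'I_n})
    (x : A) : A :=
  unop (Subst sigma) x.

Definition df_reduct n (A : polyadic_type_algebra n) : df_type_algebra n :=
  @Algebra {set 'I_n} A (@plus _ A) (@minus _ A) (@cyl_op n A).

Section SetAlgebras.
Variables (n : nat) (U : Type).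

Definition set_cyl (G : {set 'I_n}) (R : set ('I_n -> U)) : set ('I_n -> U) :=
  [set s : 'I_n -> U | exists2 z, R z & forall i, i \notin G -> z i = s i].

Definition set_subst (sigma : {ffun 'I_n -> 'I_n}) (R : set ('I_n -> U)) :
    set ('I_n -> U) :=
  [set s : 'I_n -> U | R (s \o sigma)].

Definition full_polyadic_set_algebra : polyadic_type_algebra n :=
  @Algebra (polyadic_symbol n) (set ('I_n -> U))
    (fun R S => R `|` S) (fun R => ~` R)
    (fun j => match j with
              | Cyl G => set_cyl G
              | Subst sigma => set_subst sigma
              end).

Definition full_df_set_algebra : df_type_algebra n :=
  @Algebra {set 'I_n} (set ('I_n -> U))
    (fun R S => R `|` S) (fun R => ~` R) set_cyl.

End SetAlgebras.

Definition RPA n (A : polyadic_type_algebra n) : Prop :=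
  exists (I : Type) (U : I -> Type),
    isomorphic_to_subalgebra A
      (direct_product (fun i => full_polyadic_set_algebra n (U i))).

Definition Rdf n (A : df_type_algebra n) : Prop :=
  exists (I : Type) (U : I -> Type),
    isomorphic_to_subalgebra A
      (direct_product (fun i => full_df_set_algebra n (U i))).

Definition comp_map n (sigma tau : {ffun 'I_n -> 'I_n}) : {ffun 'I_n -> 'I_n} :=
  [ffun k => sigma (tau k)].

Definition id_map n : {ffun 'I_n -> 'I_n} := [ffun k => k].

(* Main.v *)
Require Import Defs.
From mathcomp Require Import all_boot fingroup perm.
From mathcomp Require Import boolp classical_sets filter wochoice.

(** Every law of the list holds in a full polyadic set algebra, so only the
    converse needs an idea.  Let [h] be one component of a representation of
    the cylindric reduct by subsets of the tuples over [U].  Such an [h] knows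
    nothing about substitutions, so the base set is changed twice, each time
    without losing a point at which [h] separates two elements.

    First change: singular (non-injective) substitutions.  They are generated
    by the replacements [i/j] sending [j] to [i] (singular_generation), so it is
    enough to make those correct.  A point of the new base is a tuple [v] over
    [U] pretending to be a single point, [v i] being what it looks like when put
    in coordinate [i].  The replacement [i/j] is evaluated correctly if
    [v i] and [v j] are indistinguishable in the following sense: every tuple
    with entries [v i] and [v j] in coordinates [i] and [j] satisfies [x] iff it
    satisfies [s_(i/j) x].  For a given [x] this is expressed by an element
    [agree i j x] of [A], which becomes the unit under every constant
    substitution; by the law relating substitutions that differ only in [G],
    every value in a given coordinate extends to a tuple satisfying it.
    An ultrapower along an ultrafilter on such elements satisfies all these
    conditions at once (singular_representation).

    Second change: permutations.  The truth of [s_sigma x] at an injective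
    tuple, for [sigma] a permutation, can be prescribed by the truth of [x] at
    the permuted tuple.  So fix a linear order on the base, evaluate [x] at
    increasing tuples as before, and at any other injective tuple [s] evaluate
    [s_sigma x] at the increasing rearrangement of [s]; non-injective tuples are
    already right.  Cylindrification survives because a cylinder in a nonempty
    direction is the same under both evaluations: under a cylinder a permutation
    may be altered in one coordinate, which makes it singular
    (sorted_rep_cyl).  For the existence of witnesses every point gets infinitely
    many copies, one on each level of a level-first order: putting the fresh
    entries on high levels fixes the rearranging permutation before the entries
    themselves are chosen. *)

Set Implicit Arguments.
Unset Strict Implicit.
Unset Printing Implicit Defensive.

(** * Embeddings and subalgebras of products *)

Lemma sval_inj (T : Type) (P : T -> Prop) : injective (@proj1_sig T P).
Proof. by case=> [x Px] [y Py] /= xy; apply: eq_exist. Qed.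

Lemma isomorphic_to_subalgebraP J (A B : algebra J) :
  isomorphic_to_subalgebra A B <->
  exists h : A -> B, injective h /\ homomorphism h.
Proof.
split.
  case=> X [cX] [h] [h_bij] [hD hN hU].
  exists (fun x => sval (h x)); split.
    by move=> x y /sval_inj /(bij_inj h_bij).
  by split=> [x y|x|j x] /=; rewrite ?hD ?hN ?hU.
case=> h [h_inj [hD hN hU]].
pose X : set B := [set y | exists x, h x = y]%classic.
have cX : subuniverse X.
  split=> [_ _ [x <-] [y <-]|_ [x <-]|j _ [x <-]].
  - by exists (plus x y).
  - by exists (minus x).
  - by exists (unop j x).
exists X, cX, (fun x => exist X (h x) (ex_intro _ x erefl)); split.
  have [g gK] := choice (fun y : {y | X y} => svalP y).
  exists g => [x|y]; first by apply: h_inj; rewrite gK.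
  by apply: sval_inj; rewrite /= gK.
by split=> [x y|x|j x]; apply: sval_inj; rewrite /= ?hD ?hN ?hU.
Qed.

(** * Singular maps are generated by replacements *)

Lemma not_injective_collision (S : eqType) (T : Type) (f : S -> T) :
  ~ injective f -> exists i j, i != j /\ f i = f j.
Proof.
move=> ninj; apply: contrapT => H; apply: ninj => i j eij.
by apply/eqP/negPn/negP => nij; apply: H; exists i, j.
Qed.

Section SingularMaps.
Variable n : nat.
Implicit Types (i j k : 'I_n) (s : 'S_n) (sigma tau : {ffun 'I_n -> 'I_n}).

Definition replacement i j : {ffun 'I_n -> 'I_n} :=
  [ffun k => if k == j then i else k].

Definition map_of_perm s : {ffun 'I_n -> 'I_n} := [ffun k => s k].

Lemma comp_mapA sigma tau rho :
  comp_map sigma (comp_map tau rho) = comp_map (comp_map sigma tau) rho.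
Proof. by apply/ffunP=> k; rewrite !ffunE. Qed.

Lemma map_of_permM s s' :
  map_of_perm (s * s')%g = comp_map (map_of_perm s') (map_of_perm s).
Proof. by apply/ffunP=> k; rewrite !ffunE permM. Qed.

Lemma replacement_idem i j :
  i != j -> comp_map (replacement i j) (replacement i j) = replacement i j.
Proof.
move=> nij; apply/ffunP=> k; rewrite !ffunE.
by have [_|/negPf->] := eqVneq k j; rewrite ?(negPf nij).
Qed.

Lemma perm_comp_replacement s i j :
  comp_map (map_of_perm s) (replacement i j) =
  comp_map (replacement (s i) (s j)) (map_of_perm s).
Proof.
by apply/ffunP=> k; rewrite !ffunE (inj_eq perm_inj) (fun_if s).
Qed.

Section Generation.
Variable P : {ffun 'I_n -> 'I_n} -> Prop.
Hypothesis P_comp : forall sigma tau, P sigma -> P tau -> P (comp_map sigma tau).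
Hypothesis P_repl : forall i j, i != j -> P (replacement i j).

(** Read a map as an array and composition on the right with [replacement i j]
    as the assignment copying cell [i] into cell [j].  Two cells can be swapped
    by three such copies if a third cell may be overwritten; the cell [j]
    discarded by [replacement i j] is available for this, and if [j] is itself
    one of [p], [q] there is nothing to save. *)
Let P_tperm_repl p q i j :
  i != j -> P (comp_map (map_of_perm (tperm p q)) (replacement i j)).
Proof.
have Pq p' j' i' : i' != j' ->
    P (comp_map (map_of_perm (tperm p' j')) (replacement i' j')).
  move=> nij'; have [->|np'j'] := eqVneq p' j'.
    rewrite tperm1 (_ : comp_map _ _ = replacement i' j'); first exact: P_repl.
    by apply/ffunP=> k; rewrite !ffunE perm1.
  have [->|nip'] := eqVneq i' p'.
    rewrite (_ : comp_map _ _ = replacement j' p').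
      by apply: P_repl; rewrite eq_sym.
    apply/ffunP=> k; rewrite !ffunE.
    have [->|nkj] := eqVneq k j'; first by rewrite tpermL eq_sym (negPf np'j').
    by case: tpermP => [->|/eqP|/eqP/negPf->]; rewrite ?eqxx ?(negPf nkj).
  rewrite (_ : comp_map _ _ = comp_map (replacement j' p') (replacement i' j')).
    by apply: P_comp; apply: P_repl => //; rewrite eq_sym.
  apply/ffunP=> k; rewrite !ffunE; have [kj|nkj] := eqVneq k j'.
    by rewrite (negPf nip') tpermD // eq_sym.
  by case: tpermP => [->|/eqP|/eqP/negPf->]; rewrite ?eqxx ?(negPf nkj).
move=> nij; have [->|npj] := eqVneq p j; first by rewrite tpermC; apply: Pq.
have [->|nqj] := eqVneq q j; first exact: Pq.
have [->|npq] := eqVneq p q.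
  rewrite tperm1 (_ : comp_map _ _ = replacement i j); first exact: P_repl.
  by apply/ffunP=> k; rewrite !ffunE perm1.
(* [j] serves as the auxiliary cell of the swap of [p] and [q] *)
rewrite (_ : comp_map _ _ = comp_map (comp_map (replacement p j)
  (comp_map (replacement q p) (replacement j q))) (replacement i j)).
  by do !apply: P_comp; apply: P_repl; rewrite // eq_sym.
apply/ffunP=> k; rewrite !ffunE.
set l := if k == j then i else k.
have nlj : l != j by rewrite /l; case: (eqVneq k j).
case: tpermP => [->|->|/eqP nlp /eqP nlq].
- by rewrite (negPf npq) eqxx (negPf nqj).
- by rewrite eqxx [j == p]eq_sym (negPf npj) eqxx.
- by rewrite (negPf nlq) (negPf nlp) (negPf nlj).
Qed.

(** A product of transpositions is peeled off one transposition at a time: as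
    [replacement i j] is idempotent, one copy of it can be pushed through the
    remaining permutation and given to the transposition. *)
Let P_perm_repl s i j : i != j -> P (comp_map (map_of_perm s) (replacement i j)).
Proof.
have [ts -> _] := prod_tpermP s; rewrite -(revK ts) => {s}.
elim: (rev ts) i j => [|[p q] us IH] i j nij.
  rewrite big_nil (_ : comp_map _ _ = replacement i j); first exact: P_repl.
  by apply/ffunP=> k; rewrite !ffunE perm1.
rewrite rev_cons -cats1 big_cat big_seq1 /=.
set s := (\prod_(t <- rev us) _)%g in IH *.
have nsij : s i != s j by rewrite (inj_eq perm_inj).
rewrite map_of_permM -(replacement_idem nij) -comp_mapA.
rewrite (comp_mapA (map_of_perm s)) perm_comp_replacement -comp_mapA comp_mapA.
exact: P_comp (P_tperm_repl _ _ nsij) (IH _ _ nij).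
Qed.

(** Induction on the number of missing values.  If [tau i = tau j], the value at
    [j] can be changed to a missing one and restored by [replacement i j]; the
    changed map is either a permutation or a singular map with larger image. *)
Lemma singular_generation tau : ~ injective tau -> P tau.
Proof.
have [m] := ubnP (n - #|tau @: 'I_n|); elim: m tau => // m IH tau /ltnSE le_m ninj.
have [i [j [nij eij]]] := not_injective_collision ninj.
have [k kP] : exists k, k \notin tau @: 'I_n.
  apply: contrapT => H; apply: ninj.
  have tauT : tau @: 'I_n =i 'I_n.
    move=> k; rewrite inE.
    by apply/negPn/negP => kP; apply: H; exists k.
  have /imset_injP inj : #|tau @: 'I_n| == #|'I_n| by rewrite (eq_card tauT).
  by move=> i' j' e; apply: inj.
pose tau' := [ffun l => if l == j then k else tau l].
have -> : tau = comp_map tau' (replacement i j).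
  apply/ffunP=> l; rewrite !ffunE.
  by have [->|/negPf->//] := eqVneq l j; rewrite (negPf nij).
have [inj'|ninj'] := pselect (injective tau').
  have -> : tau' = map_of_perm (perm inj').
    by apply/ffunP=> l; rewrite !ffunE permE ffunE.
  exact: P_perm_repl.
apply: P_comp (P_repl nij); apply: IH => //; apply: leq_trans le_m.
have im_sub : k |: tau @: 'I_n \subset tau' @: 'I_n.
  apply/fintype.subsetP=> l /setU1P[->|/imsetP[l' _ ->]].
    by apply/imsetP; exists j; rewrite ?ffunE ?eqxx.
  have [->|nl'j] := eqVneq l' j.
    by apply/imsetP; exists i; rewrite ?ffunE ?(negPf nij).
  by apply/imsetP; exists l'; rewrite ?ffunE ?(negPf nl'j).
have := subset_leq_card im_sub; rewrite cardsU1 kP add1n => lt_im.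
apply: ltn_sub2l => //; apply: leq_trans lt_im _.
by rewrite -[leqRHS](card_ord n) max_card.
Qed.

End Generation.
End SingularMaps.

(** * The laws of set algebras *)

Record substitution_laws n (A : polyadic_type_algebra n) : Prop := SubstitutionLaws {
  subst_plus : forall (sigma : {ffun 'I_n -> 'I_n}) (x y : A),
    subst_op sigma (plus x y) = plus (subst_op sigma x) (subst_op sigma y);
  subst_minus : forall (sigma : {ffun 'I_n -> 'I_n}) (x : A),
    subst_op sigma (minus x) = minus (subst_op sigma x);
  subst_comp : forall (sigma tau : {ffun 'I_n -> 'I_n}) (x : A),
    subst_op (comp_map sigma tau) x = subst_op sigma (subst_op tau x);
  subst_id : forall x : A, subst_op (id_map n) x = x;
  subst_cyl_ext : forall (G : {set 'I_n}) (sigma tau : {ffun 'I_n -> 'I_n}) (x : A),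
    (forall i : 'I_n, i \notin G -> sigma i = tau i) ->
    subst_op sigma (cyl_op G x) = subst_op tau (cyl_op G x);
  cyl_subst : forall (G : {set 'I_n}) (sigma : {ffun 'I_n -> 'I_n}) (x : A),
    {in sigma @^-1: G &, injective sigma} ->
    cyl_op G (subst_op sigma x) = subst_op sigma (cyl_op (sigma @^-1: G) x)
}.

Section SetAlgebraLaws.
Local Open Scope classical_set_scope.
Variables (n : nat) (U : Type).
Implicit Types (G : {set 'I_n}) (sigma tau : {ffun 'I_n -> 'I_n}).
Implicit Types (R : set ('I_n -> U)).

Lemma set_subst_comp sigma tau R :
  set_subst (comp_map sigma tau) R = set_subst sigma (set_subst tau R).
Proof.
apply/seteqP; split=> s; rewrite /set_subst /=;
  by congr (R _); apply/funext=> k; rewrite /= ffunE.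
Qed.

Lemma set_subst_id R : set_subst (id_map n) R = R.
Proof.
by apply/seteqP; split=> s; rewrite /set_subst /=;
  congr (R _); apply/funext=> k; rewrite /= ffunE.
Qed.

Lemma set_cyl_closed G R (s z : 'I_n -> U) :
  (forall i, i \notin G -> z i = s i) -> set_cyl G R z -> set_cyl G R s.
Proof.
move=> zs [w Rw wz]; exists w => // i iG.
by rewrite wz ?zs.
Qed.

Lemma set_subst_cyl_ext G sigma tau R :
  (forall i, i \notin G -> sigma i = tau i) ->
  set_subst sigma (set_cyl G R) = set_subst tau (set_cyl G R).
Proof.
by move=> st; apply/seteqP; split=> s; apply: set_cyl_closed => i iG /=; rewrite st.
Qed.

Lemma set_cyl_subst G sigma R : {in sigma @^-1: G &, injective sigma} ->
  set_cyl G (set_subst sigma R) = set_subst sigma (set_cyl (sigma @^-1: G) R).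
Proof.
move=> inj; apply/seteqP; split=> s [z Rz zs].
  by exists (z \o sigma) => // i; rewrite inE => iG; apply: zs.
(* [w] transports [z] along [sigma]; injectivity on the preimage of [G] makes
   this well defined on [G], and off [G] the tuple [s] dictates the value *)
pose w i := if [pick k in sigma @^-1: G | sigma k == i] is Some k then z k else s i.
exists w => [|i iG]; last first.
  rewrite /w; case: pickP => // k /andP[]; rewrite inE => kG /eqP ki.
  by rewrite -ki kG in iG.
rewrite /set_subst /= (_ : w \o sigma = z) //; apply/funext=> k /=; rewrite /w.
case: pickP => [k' /andP[k'G /eqP e]|none].
  by congr z; apply: inj => //; move: k'G; rewrite !inE e.
rewrite zs //; apply/negP=> kG.
by have := none k; rewrite kG eqxx.
Qed.

End SetAlgebraLaws.

Lemma RPA_laws n (A : polyadic_type_algebra n) :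
  RPA A -> Rdf (df_reduct A) /\ substitution_laws A.
Proof.
case=> I [U] /isomorphic_to_subalgebraP [h [h_inj [hD hN hU]]].
split.
  exists I, U; apply/isomorphic_to_subalgebraP; exists h; split=> //.
  by split=> // j x; rewrite /= /cyl_op hU.
split=> [sigma x y|sigma x|sigma tau x|x|G sigma tau x st|G sigma x inj];
  apply: h_inj; rewrite /subst_op /cyl_op !(hU, hD, hN) //=;
  apply: functional_extensionality_dep => a.
- exact: set_subst_comp.
- exact: set_subst_id.
- exact: set_subst_cyl_ext.
- exact: set_cyl_subst.
Qed.

Definition meet J (A : algebra J) (x y : A) : A := minus (plus (minus x) (minus y)).

Definition symdiff J (A : algebra J) (x y : A) : A :=
  plus (meet x (minus y)) (meet (minus x) y).

Section RdfLaws.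
Local Open Scope classical_set_scope.
Variables (n : nat) (A : df_type_algebra n).
Hypothesis A_Rdf : Rdf A.

Lemma Rdf_plus_cyl G (x : A) : plus x (unop G x) = unop G x.
Proof.
case: A_Rdf => I [U] /isomorphic_to_subalgebraP [h [h_inj [hD hN hU]]].
apply: h_inj; rewrite hD hU; apply: functional_extensionality_dep => a /=.
by apply/setUidPr => s hs; exists s.
Qed.

Lemma Rdf_cyl0 (x : A) : unop finset.set0 x = x.
Proof.
case: A_Rdf => I [U] /isomorphic_to_subalgebraP [h [h_inj [hD hN hU]]].
apply: h_inj; rewrite hU; apply: functional_extensionality_dep => a /=.
apply/seteqP; split=> s; last by exists s.
case=> z hz zs; have -> // : s = z.
by apply/funext=> i; rewrite zs ?inE.
Qed.

Lemma Rdf_cyl_symdiff G (x : A) : unop G (symdiff x x) = symdiff x x.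
Proof.
case: A_Rdf => I [U] /isomorphic_to_subalgebraP [h [h_inj [hD hN hU]]].
have h0 a : h (symdiff x x) a = set0.
  by rewrite /symdiff /meet !(hD, hN) /= !setCU !setCK setICr setICl setU0.
apply: h_inj; rewrite hU; apply: functional_extensionality_dep => a /=.
by rewrite h0; apply/seteqP; split=> // s [].
Qed.

End RdfLaws.

(** * An ultrapower respecting singular substitutions *)

Definition singular_compatible n (A : polyadic_type_algebra n) (V : Type)
    (h : A -> set ('I_n -> V)) :=
  forall tau : {ffun 'I_n -> 'I_n}, ~ injective tau ->
  forall x s, h x (s \o tau) <-> h (subst_op tau x) s.

Section Ultrapower.
Local Open Scope classical_set_scope.
Variables (n : nat) (A : polyadic_type_algebra n).
Hypotheses (A_Rdf : Rdf (df_reduct A)) (A_laws : substitution_laws A).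
Variables (U : Type) (h : A -> set ('I_n -> U)).
Hypothesis h_hom : @homomorphism _ (df_reduct A) (full_df_set_algebra n U) h.

Let hD x y : h (plus x y) = h x `|` h y. Proof. by case: h_hom => H _ _; apply: H. Qed.
Let hN x : h (minus x) = ~` h x. Proof. by case: h_hom => _ H _; apply: H. Qed.
Let hC G x : h (cyl_op G x) = set_cyl G (h x).
Proof. by case: h_hom => _ _ H; apply: H. Qed.
Let hI x y : h (meet x y) = h x `&` h y.
Proof. by rewrite /meet hN hD !hN setCU !setCK. Qed.

Definition const_map i : {ffun 'I_n -> 'I_n} := [ffun => i].

(** Elements true at every constant tuple of a base respecting substitutions;
    since no such base is available yet, this is said through the constant
    substitutions. *)
Definition diagonal_valid y := forall i, h (subst_op (const_map i) y) = setT.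

Lemma diagonal_valid_meet x y :
  diagonal_valid x -> diagonal_valid y -> diagonal_valid (meet x y).
Proof.
move=> Dx Dy i.
rewrite /meet (subst_minus A_laws) (subst_plus A_laws) !(subst_minus A_laws).
by rewrite hI Dx Dy setIT.
Qed.

Lemma diagonal_valid_top x : diagonal_valid (plus x (minus x)).
Proof.
by move=> i; rewrite (subst_plus A_laws) (subst_minus A_laws) hD hN setUCr.
Qed.

(** This provides the imitations of a given point in the other coordinates.
    Under the cylinder in the coordinates other than [i], the identity may be
    replaced by the constant map [i], and [y <= c y] becomes the unit there. *)
Lemma diagonal_valid_extend y : diagonal_valid y ->
  forall (u : 'I_n -> U) i, exists2 w, h y w & w i = u i.
Proof.
move=> Dy u i; have : h (cyl_op (~: [set i]) y) u.
  rewrite -(subst_id A_laws (cyl_op _ y)).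
  rewrite (subst_cyl_ext A_laws (tau := const_map i)); last first.
    by move=> j; rewrite !inE negbK => /eqP->; rewrite !ffunE.
  have <- : plus y (cyl_op (~: [set i]) y) = cyl_op (~: [set i]) y.
    exact: Rdf_plus_cyl A_Rdf _ _.
  by rewrite (subst_plus A_laws) hD Dy; left.
by rewrite hC => -[w hw wu]; exists w => //; apply: wu; rewrite !inE eqxx.
Qed.

(** True at a tuple iff [x] and its replacement [i/j] coincide at all tuples with
    the same entries in coordinates [i] and [j]. *)
Definition agree i j x : A :=
  minus (cyl_op (~: [set i; j]) (symdiff x (subst_op (replacement i j) x))).

(** A constant map absorbs [replacement i j] on the right.  As [replacement i j]
    commutes with the cylinder in the other coordinates and is idempotent, it
    turns the symmetric difference in [agree i j x] into the zero element. *)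
Lemma diagonal_valid_agree i j x : i != j -> diagonal_valid (agree i j x).
Proof.
move=> nij k; rewrite /agree; set r := replacement i j; set w := symdiff _ _.
have constr : comp_map (const_map k) r = const_map k.
  by apply/ffunP=> l; rewrite !ffunE.
have r_pre : r @^-1: (~: [set i; j]) = ~: [set i; j].
  apply/finset.setP=> l; rewrite !inE ffunE.
  by have [->|/negPf nlj] := eqVneq l j; rewrite ?eqxx ?orbT // nlj.
have r_inj : {in r @^-1: (~: [set i; j]) &, injective r}.
  rewrite r_pre => a b; rewrite !inE !negb_or !ffunE => /andP[_ /negPf->].
  by move=> /andP[_ /negPf->].
have rw : subst_op r w = symdiff (subst_op r x) (subst_op r x).
  rewrite /w /symdiff /meet !(subst_plus A_laws, subst_minus A_laws).
  by rewrite -(subst_comp A_laws) replacement_idem.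
have rc : subst_op r (cyl_op (~: [set i; j]) w) =
    symdiff (subst_op r x) (subst_op r x).
  rewrite -[in LHS]r_pre -(cyl_subst A_laws _ r_inj) rw.
  exact: Rdf_cyl_symdiff A_Rdf _ _.
rewrite (subst_minus A_laws) -constr (subst_comp A_laws) rc.
rewrite /symdiff /meet !(subst_plus A_laws, subst_minus A_laws).
by rewrite !(hD, hN) !setCU !setCK setICr setICl setC0 setTI.
Qed.

Lemma agreeP i j x w z : h (agree i j x) w -> z i = w i -> z j = w j ->
  h x z <-> h (subst_op (replacement i j) x) z.
Proof.
rewrite /agree hN hC => Hw zi zj.
have {Hw} : ~ h (symdiff x (subst_op (replacement i j) x)) z.
  move=> hz; apply: Hw; exists z => // k.
  by rewrite !inE negbK => /orP[] /eqP->.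
rewrite /symdiff hD !hI !hN => H; split=> hz; apply: contrapT => nz; apply: H.
  by left.
by right.
Qed.

(** The coordinate [j] is not in the range of [replacement i j]. *)
Lemma replacement_independent i j x z w : i != j ->
  (forall k, k != j -> z k = w k) ->
  h (subst_op (replacement i j) x) z <-> h (subst_op (replacement i j) x) w.
Proof.
move=> nij zw; set r := replacement i j.
have r_pre : r @^-1: [set j]%SET = finset.set0.
  apply/finset.setP=> l; rewrite !inE ffunE.
  by have [_|/negPf] := eqVneq l j; first exact: negPf.
have rx : subst_op r x = cyl_op [set j]%SET (subst_op r x).
  rewrite (cyl_subst A_laws) r_pre; last by move=> a b; rewrite inE.
  by congr (subst_op _ _); symmetry; exact: (Rdf_cyl0 A_Rdf).
rewrite rx hC; split; apply: set_cyl_closed => k; rewrite inE => nkj.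
  by rewrite zw.
by rewrite zw.
Qed.

Lemma singular_compatible_replacement V (k : A -> set ('I_n -> V)) :
  (forall i j, i != j -> forall x s,
    k x (s \o replacement i j) <-> k (subst_op (replacement i j) x) s) ->
  singular_compatible k.
Proof.
move=> kr tau; apply: (@singular_generation _
  (fun tau => forall x s, k x (s \o tau) <-> k (subst_op tau x) s)) => //.
move=> sigma tau' ks kt x s.
rewrite (subst_comp A_laws) -ks -kt.
by rewrite (_ : s \o comp_map sigma tau' = (s \o sigma) \o tau') //;
  apply/funext=> l; rewrite /= ffunE.
Qed.

(** The index set of the ultrapower is [A], and the ultrafilter [G] lives on the
    elements valid on the diagonal, directed downwards.  A point of the new base
    chooses, at each index [y], a tuple in [h y]; hence it satisfies each such
    element at almost all indices, the elements [agree i j x] in particular. *)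
Lemma singular_representation : A -> exists (V : Type) (k : A -> set ('I_n -> V)),
  [/\ @homomorphism _ (df_reduct A) (full_df_set_algebra n V) k,
      singular_compatible k &
      forall u, exists s, forall x, k x s <-> h x u].
Proof.
move=> x0.
pose V := {v : A -> 'I_n -> U | forall y, diagonal_valid y -> h y (v y)}.
pose below y := [set y' | diagonal_valid y' /\ h y' `<=` h y].
have [G [G_ultra G_below]] : exists G, UltraFilter G /\
    forall y, diagonal_valid y -> G (below y).
  have F_proper : ProperFilter (filter_from diagonal_valid below).
    apply: filter_from_proper; last by move=> y Dy; exists y; split.
    apply: filter_from_filter.
      by exists (plus x0 (minus x0)); exact: diagonal_valid_top.
    move=> y z Dy Dz; exists (meet y z); first exact: diagonal_valid_meet.
    by move=> t [Dt]; rewrite hI subsetI => -[ty tz]; split; split.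
  have [G [GU FG]] := ultraFilterLemma F_proper.
  by exists G; split=> // y Dy; apply: FG; exists y.
have GF : Filter G by exact: filter_filter.
(* a point of [V] may have any prescribed entries in one coordinate *)
have lift (f : A -> 'I_n -> U) i : exists v : V, forall y, sval v y i = f y i.
  have [g gP] : {g : A -> 'I_n -> U &
      forall y, (diagonal_valid y -> h y (g y)) /\ g y i = f y i}.
    apply: (@choice _ _ (fun y w => (diagonal_valid y -> h y w) /\ w i = f y i)) => y.
    have [Dy|nDy] := pselect (diagonal_valid y).
      by have [w hw wi] := diagonal_valid_extend Dy (f y) i; exists w.
    by exists (f y).
  exists (exist _ g (fun y => (gP y).1)) => y; exact: (gP y).2.
(* the point in coordinate [i] shows its [i]-th face *)
pose row (s : 'I_n -> V) y : 'I_n -> U := fun i => sval (s i) y i.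
pose k x : set ('I_n -> V) := [set s | G [set y | h x (row s y)]].
exists V, k; split.
- split=> [x y|x|Gm x] /=.
  + apply/seteqP; split=> s; rewrite /k /=.
      move=> Gxy.
      have [|Gn] := in_ultra_setVsetC [set a | h x (row s a)] G_ultra; first by left.
      right; apply: filterS2 Gxy Gn => a /=.
      by rewrite hD => -[hx nhx|//]; case: (nhx hx).
    by case; apply: filterS => a /= ha; rewrite hD; [left|right].
  + apply/seteqP; split=> s; rewrite /k /=.
      move=> Gnx Gx; apply: (@filter_not_empty _ G _).
      by apply: filterS2 Gnx Gx => a /=; rewrite hN.
    move=> nG; have [//|] := in_ultra_setVsetC [set a | h x (row s a)] G_ultra.
    by apply: filterS => a /=; rewrite hN.
  + apply/seteqP; split=> s; rewrite /k /=; last first.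
      case=> z Gz zs; apply: filterS Gz => a /= hz; rewrite hC.
      by exists (row z a) => // i iG; rewrite /row zs.
    move=> GC.
    have [r rP] : {r : A -> 'I_n -> U & forall y,
        (h (cyl_op Gm x) (row s y) -> h x (r y)) /\
        forall i, i \notin Gm -> r y i = row s y i}.
      apply: (@choice _ _ (fun y w => (h (cyl_op Gm x) (row s y) -> h x w) /\
        forall i, i \notin Gm -> w i = row s y i)) => y.
      have [|nC] := pselect (h (cyl_op Gm x) (row s y)).
        by rewrite hC => -[w hw ws]; exists w.
      by exists (row s y).
    have [v vP] := choice (lift r).
    pose z i := if i \in Gm then v i else s i.
    exists z => [|i /negPf iG]; last by rewrite /z iG.
    apply: filterS GC => a /= /(rP a).1; congr (h x _); apply/funext=> i.
    rewrite /row /z; case: ifPn => iG; first by rewrite vP.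
    by rewrite (rP a).2.
- apply: singular_compatible_replacement => i j nij x s.
  have GB := G_below _ (diagonal_valid_agree x nij).
  have eq_on : G [set y | h x (row (s \o replacement i j) y) <->
                          h (subst_op (replacement i j) x) (row s y)].
    apply: filterS GB => y [Dy hy].
    (* coordinates [i] and [j] of this row are faces of the same point [s i] *)
    pose z := row (s \o replacement i j) y; rewrite /= -/z.
    rewrite (agreeP (w := sval (s i) y) (z := z)); last 3 first.
    + exact: hy (svalP (s i) _ Dy).
    + by rewrite /z /row /= ffunE (negPf nij).
    + by rewrite /z /row /= ffunE eqxx.
    apply: replacement_independent => // l nlj.
    by rewrite /z /row /= ffunE (negPf nlj).
  by split=> H; apply: filterS2 eq_on H => y /= [H1 H2].
- move=> u; have [v vP] := choice (lift (fun=> u)).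
  exists v => x; rewrite /k /=.
  have -> : [set y | h x (row v y)] = [set _ | h x u].
    by apply/funext=> y /=; congr (h x _); apply/funext=> i; rewrite /row vP.
  split=> [/filter_ex[]//|hu]; exact: filterE.
Qed.

End Ultrapower.

(** * Sorting tuples along a linear order *)

Lemma strict_total_order_exists (T : Type) : exists lt : rel T,
  [/\ irreflexive lt, transitive lt &
      forall x y, x <> y -> lt x y || lt y x].
Proof.
suff: forall T' : eqType, exists lt : rel T',
    [/\ irreflexive lt, transitive lt & forall x y, x <> y -> lt x y || lt y x].
  by move/(_ {classic T}).
move=> {}T; have [R Rwo] := well_ordering_principle T.
have wo : wo_chain R predT by exact: withinW.
have Rtot : total R by move=> x y; apply: (wo_chainW wo).
have Ranti : antisymmetric R by move=> x y; apply: (wo_chain_antisymmetric wo).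
exists (fun x y => R x y && (x != y)); split.
- by move=> x; rewrite eqxx andbF.
- move=> y x z /andP[Rxy nxy] /andP[Ryz nyz].
  (* transitivity comes from the least element of [{x, y, z}] *)
  have [|w [[wP wmin] _]] := Rwo (mem [:: x; y; z]).
    by exists x; rewrite inE eqxx.
  have Rw t : t \in [:: x; y; z] -> R w t by exact: wmin.
  have Rxz : R x z.
    move: wP; rewrite !inE => /or3P[] /eqP w_eq; subst w.
    + by apply: Rw; rewrite !inE eqxx !orbT.
    + have xy : x = y by apply: Ranti; rewrite Rxy Rw // !inE eqxx.
      by rewrite xy eqxx in nxy.
    + have yz : y = z by apply: Ranti; rewrite Ryz Rw // !inE eqxx orbT.
      by rewrite yz eqxx in nyz.
  rewrite Rxz; apply/eqP=> xz; subst z.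
  have xy : x = y by apply: Ranti; rewrite Rxy.
  by rewrite xy eqxx in nxy.
- by move=> x y /eqP nxy; rewrite [y == x]eq_sym nxy !andbT; apply: Rtot.
Qed.

Section Sorting.
Variables (n : nat) (W : Type) (lt : rel W).

Lemma rank_subproof (s : 'I_n -> W) (irr : irreflexive lt) i :
  #|[pred j | lt (s j) (s i)]| < n.
Proof.
rewrite -[ltnRHS]card_ord; apply: proper_card; apply/fintype.properP; split.
  exact/fintype.subsetP.
by exists i; rewrite // inE irr.
Qed.

Variable lt_irr : irreflexive lt.

Definition rank (s : 'I_n -> W) : {ffun 'I_n -> 'I_n} :=
  [ffun i => Ordinal (rank_subproof s lt_irr i)].

(** The permutation [p] such that [s \o p^-1] is increasing.  The value [1] at
    non-injective [s] is essential: such tuples are to be left alone. *)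
Definition sorting (s : 'I_n -> W) : 'S_n :=
  if pselect (injective (rank s)) is left inj then perm inj else 1%g.

Lemma sorting_ext (s z : 'I_n -> W) :
  (forall i j, lt (s i) (s j) = lt (z i) (z j)) -> sorting s = sorting z.
Proof.
move=> e; rewrite /sorting (_ : rank s = rank z) //.
apply/ffunP=> i; rewrite !ffunE; apply: val_inj => /=.
by apply: eq_card => j; rewrite !inE e.
Qed.

Lemma sorting_not_injective (s : 'I_n -> W) : ~ injective s -> sorting s = 1%g.
Proof.
move=> ninj; rewrite /sorting; case: pselect => // inj.
case: ninj => i j e; apply: inj; rewrite !ffunE; apply: val_inj => /=.
by rewrite e.
Qed.

Hypothesis lt_trans : transitive lt.
Hypothesis lt_total : forall x y, x <> y -> lt x y || lt y x.

Lemma rank_inj (s : 'I_n -> W) : injective s -> injective (rank s).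
Proof.
move=> inj i j e; apply: contrapT => nij.
have lt_rank a b : lt (s a) (s b) -> (rank s a < rank s b)%N.
  move=> ab; rewrite !ffunE /=; apply: proper_card; apply/fintype.properP; split.
    by apply/fintype.subsetP=> l; rewrite !inE => la; apply: lt_trans ab.
  by exists a; rewrite !inE ?lt_irr.
have := lt_total (fun e => nij (inj _ _ e)).
by case/orP => /lt_rank; rewrite e ltnn.
Qed.

Lemma sortingE (s : 'I_n -> W) : injective s ->
  forall i, sorting s i = #|[pred j | lt (s j) (s i)]| :> nat.
Proof.
move=> inj i; rewrite /sorting; case: pselect => [rinj|]; last first.
  by case; apply: rank_inj.
by rewrite permE ffunE.
Qed.

Lemma sorting_perm (s : 'I_n -> W) (t : 'S_n) : injective s ->
  sorting (s \o t) = (t * sorting s)%g.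
Proof.
move=> inj; apply/permP=> i; apply: val_inj.
rewrite /= permM !sortingE //; last first.
  exact: inj_comp inj perm_inj.
by rewrite -!sum1_card [RHS](reindex_inj (@perm_inj _ t)).
Qed.

End Sorting.

Section LevelFirst.
Variable V : Type.
Variable ltV : rel V.
Hypotheses (ltV_irr : irreflexive ltV) (ltV_trans : transitive ltV).
Hypothesis ltV_total : forall x y, x <> y -> ltV x y || ltV y x.

Definition level_lt : rel (V * nat) :=
  fun v w => (v.2 < w.2)%N || (v.2 == w.2) && ltV v.1 w.1.

Lemma level_lt_irr : irreflexive level_lt.
Proof. by move=> v; rewrite /level_lt ltnn eqxx ltV_irr. Qed.

Lemma level_lt_trans : transitive level_lt.
Proof.
move=> y x z /orP[xy|/andP[/eqP xy xy1]] /orP[yz|/andP[/eqP yz yz1]]; apply/orP.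
- by left; apply: ltn_trans yz.
- by left; rewrite -yz.
- by left; rewrite xy.
- by right; rewrite xy yz eqxx (ltV_trans xy1).
Qed.

Lemma level_lt_total (v w : V * nat) : v <> w -> level_lt v w || level_lt w v.
Proof.
case: v w => [v a] [w b] nvw; rewrite /level_lt /=.
have [//|//|ab] := ltngtP a b.
by apply: ltV_total => vw; apply: nvw; rewrite vw ab.
Qed.

End LevelFirst.

Section Sorted.
Local Open Scope classical_set_scope.
Variables (n : nat) (A : polyadic_type_algebra n).
Implicit Types (x : A) (G : {set 'I_n}).
Hypotheses (n_gt1 : 1 < n) (A_laws : substitution_laws A).
Variables (V : Type) (k : A -> set ('I_n -> V)).
Hypothesis k_hom : @homomorphism _ (df_reduct A) (full_df_set_algebra n V) k.
Hypothesis k_sing : singular_compatible k.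

Let kD x y : k (plus x y) = k x `|` k y. Proof. by case: k_hom => H _ _; apply: H. Qed.
Let kN x : k (minus x) = ~` k x. Proof. by case: k_hom => _ H _; apply: H. Qed.
Let kC G x : k (cyl_op G x) = set_cyl G (k x).
Proof. by case: k_hom => _ _ H; apply: H. Qed.

Variable ltV : rel V.
Hypotheses (ltV_irr : irreflexive ltV) (ltV_trans : transitive ltV).
Hypothesis ltV_total : forall v w, v <> w -> ltV v w || ltV w v.
Let lt : rel (V * nat) := level_lt ltV.
Let sorting := @sorting n _ lt (level_lt_irr ltV_irr).

Definition sorted_tuple (s : 'I_n -> V * nat) : 'I_n -> V :=
  fun i => (s ((sorting s)^-1%g i)).1.

Definition sorted_rep (x : A) : set ('I_n -> V * nat) :=
  [set s | k (subst_op (map_of_perm (sorting s)) x) (sorted_tuple s)].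

Let fsts (s : 'I_n -> V * nat) i := (s i).1.

Lemma sorted_tupleK s : sorted_tuple s \o map_of_perm (sorting s) = fsts s.
Proof. by apply/funext=> i; rewrite /sorted_tuple /= ffunE permK. Qed.

Lemma perm_cyl (p : 'S_n) G x : subst_op (map_of_perm p) (cyl_op G x) =
  cyl_op (p @: G) (subst_op (map_of_perm p) x).
Proof.
rewrite (cyl_subst A_laws); last by move=> i j _ _; rewrite !ffunE => /perm_inj.
congr (subst_op _ (cyl_op _ _)); apply/finset.setP=> i.
by rewrite inE ffunE mem_imset //; apply: perm_inj.
Qed.

(** The idea that makes rearranging harmless for cylindrifications: the sorting
    permutation acts on a cylinder in direction [G], hence may be modified at a
    point [j] of [G] into a singular map, for which [k] is correct. *)
Lemma sorted_rep_cyl G x s : G != finset.set0 ->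
  sorted_rep (cyl_op G x) s <-> k (cyl_op G x) (fsts s).
Proof.
case/set0Pn => j jG; pose p := sorting s.
have [l nlj] : exists l : 'I_n, l != j.
  have : 1 < #|'I_n| by rewrite card_ord.
  move=> /card_gt1P[a [b [_ _ nab]]].
  by have [aj|] := eqVneq a j; [exists b; rewrite -aj eq_sym|exists a].
pose p' := comp_map (map_of_perm p) (replacement l j).
have p'_sing : ~ injective p'.
  move=> inj; move/eqP: nlj; apply; apply: inj.
  by rewrite !ffunE eqxx; case: ifP.
rewrite /sorted_rep /= (subst_cyl_ext A_laws (tau := p')); last first.
  by move=> i iG; rewrite !ffunE; have [ij|//] := eqVneq i j; rewrite ij jG in iG.
rewrite -k_sing // kC.
have off i : i \notin G -> (sorted_tuple s \o p') i = fsts s i.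
  move=> iG; rewrite -sorted_tupleK /p' /= !ffunE.
  by have [ij|//] := eqVneq i j; rewrite ij jG in iG.
by split; apply: set_cyl_closed => i iG; rewrite off.
Qed.

(** If [s \o tau] is injective, [tau] is a permutation and sorting is
    equivariant.  Otherwise [s \o tau] is evaluated directly by [k], and a
    singular map carries it to [s] or to its rearrangement. *)
Lemma sorted_rep_subst (tau : {ffun 'I_n -> 'I_n}) x s :
  sorted_rep x (s \o tau) <-> sorted_rep (subst_op tau x) s.
Proof.
have sE y z : ~ injective z -> sorted_rep y z <-> k y (fsts z).
  move=> nz; rewrite /sorted_rep /= -sorted_tupleK /sorting sorting_not_injective //.
  rewrite (_ : map_of_perm 1%g = id_map n).
    rewrite (subst_id A_laws) (_ : _ \o _ = sorted_tuple z) //.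
    by apply/funext=> i; rewrite /= ffunE.
  by apply/ffunP=> i; rewrite !ffunE perm1.
have [inj|ninj] := pselect (injective (s \o tau)).
  have tau_inj : injective tau by apply: inj_compr inj.
  have [t tauE] : exists t, tau = map_of_perm t.
    by exists (perm tau_inj); apply/ffunP=> i; rewrite ffunE permE.
  have s_inj : injective s.
    move=> i j; rewrite -(permKV t i) -(permKV t j) => e; congr (t _).
    by apply: inj; rewrite /= tauE !ffunE.
  have -> : s \o tau = s \o t by apply/funext=> i; rewrite /= tauE ffunE.
  rewrite /sorted_rep /sorted_tuple /= /sorting sorting_perm //; last 2 first.
  - exact: level_lt_trans ltV_trans.
  - exact: level_lt_total ltV_total.
  rewrite map_of_permM (subst_comp A_laws) -tauE.
  by rewrite -propeqE; congr (k _ _); apply/funext=> i; rewrite invMg permM permKV.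
rewrite sE //; have [s_inj|s_ninj] := pselect (injective s).
  rewrite /sorted_rep /= -(subst_comp A_laws) -k_sing; last first.
    by move=> inj; apply: ninj => i j /s_inj e; apply: inj; rewrite !ffunE e.
  rewrite -propeqE; congr (k _ _); apply/funext=> i.
  by rewrite -[LHS]/(fsts s (tau i)) -sorted_tupleK /= !ffunE.
rewrite sE //.
(* [s] factors through a replacement, which makes even a permutation [tau]
   singular once composed with it *)
have [i [j [nij eij]]] := not_injective_collision s_ninj.
have r_off l : replacement i j l != j.
  by rewrite ffunE; case: (eqVneq l j).
have sr : fsts s \o replacement i j = fsts s.
  apply/funext=> l; rewrite /fsts /= ffunE.
  by have [->|//] := eqVneq l j; rewrite eij.
have sing (r : {ffun 'I_n -> 'I_n}) : (forall l, r l != j) -> ~ injective r.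
  move=> rj inj; have /codomP[l e] : j \in codom r by exact: injF_onto.
  by move: (rj l); rewrite -e eqxx.
rewrite -[in X in _ <-> X]sr k_sing; last exact: sing.
rewrite -(subst_comp A_laws) -k_sing; last by apply: sing => l; rewrite ffunE r_off.
rewrite -propeqE; congr (k _ _); apply/funext=> l.
transitivity ((fsts s \o replacement i j) (tau l)); first by rewrite sr.
by rewrite /= !ffunE.
Qed.

(** For the inclusion from left to right, the entries in [G] are first lifted to
    distinct levels above all others.  The sorting permutation of the resulting
    [z0] then depends on these levels only, so it stays the same when the
    components in [V] are replaced by those of a witness. *)
Lemma sorted_rep_cyl_hom G x : sorted_rep (cyl_op G x) = set_cyl G (sorted_rep x).
Proof.
apply/seteqP; split=> s; last first.
  case=> z xz zs.
  have Cz : sorted_rep (cyl_op G x) z.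
    by rewrite /sorted_rep /= perm_cyl kC; exists (sorted_tuple z).
  have [G0|GN] := eqVneq G finset.set0.
    by rewrite (_ : s = z) //; apply/funext=> i; rewrite zs // G0 inE.
  move: Cz; rewrite !sorted_rep_cyl // kC; apply: set_cyl_closed => i iG.
  by rewrite /fsts zs.
move=> Cs; pose L := (\max_i (s i).2).+1.
pose z0 i := if i \in G then ((s i).1, L + i) else s i.
have Cz0 : sorted_rep (cyl_op G x) z0.
  have [G0|GN] := eqVneq G finset.set0.
    by rewrite (_ : z0 = s) //; apply/funext=> i; rewrite /z0 G0 inE.
  move: Cs; rewrite !sorted_rep_cyl // kC; apply: set_cyl_closed => i /negPf iG.
  by rewrite /fsts /z0 iG.
move: Cz0; rewrite {1}/sorted_rep /= perm_cyl kC => -[t kt tz0].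
pose p := sorting z0.
pose z i := (t (p i), (z0 i).2).
have z_off i : i \notin G -> z i = z0 i.
  move=> iG; rewrite /z tz0 ?mem_imset //; last exact: perm_inj.
  by rewrite /sorted_tuple permK -surjective_pairing.
have sz : sorting z = p.
  apply: sorting_ext => i j.
  have [e|/negPf ne] := eqVneq (z0 i).2 (z0 j).2; last first.
    by rewrite /lt /level_lt /= ne.
  have le_L l : l \notin G -> (z0 l).2 < L.
    by move=> /negPf lG; rewrite /z0 lG ltnS (leq_bigmax l).
  have ge_L l : l \in G -> (z0 l).2 = (L + l)%N by move=> lG; rewrite /z0 lG.
  have [iG|iG] := boolP (i \in G); have [jG|jG] := boolP (j \in G).
  - have -> : i = j by apply/val_inj/eqP; rewrite -(eqn_add2l L) -!ge_L // e.
    by rewrite /lt !(level_lt_irr ltV_irr).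
  - by have := le_L _ jG; rewrite -e ge_L // ltnNge leq_addr.
  - by have := le_L _ iG; rewrite e ge_L // ltnNge leq_addr.
  - by rewrite !z_off.
exists z; last first.
  by move=> i iG; rewrite z_off // /z0 (negPf iG).
rewrite /sorted_rep /= sz (_ : sorted_tuple z = t) //.
by apply/funext=> i; rewrite /sorted_tuple sz /z /= permKV.
Qed.

Lemma sorted_rep_hom :
  @homomorphism _ A (full_polyadic_set_algebra n (V * nat)) sorted_rep.
Proof.
split=> [x y|x|[G|tau] x].
- by apply/seteqP; split=> s; rewrite /sorted_rep /= (subst_plus A_laws) kD.
- by apply/seteqP; split=> s; rewrite /sorted_rep /= (subst_minus A_laws) kN.
- exact: sorted_rep_cyl_hom.
- by apply/seteqP; split=> s; apply sorted_rep_subst.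
Qed.

(** Increasing levels make the tuple increasing, whatever its entries in [V]. *)
Lemma sorted_rep_separates x s :
  sorted_rep x (fun i => (s i, i : nat)) <-> k x s.
Proof.
set z := fun i => _.
have sz : sorting z = 1%g.
  have z_inj : injective z by move=> i j [_] /val_inj.
  apply/permP=> i; apply: val_inj; rewrite /= perm1 /sorting sortingE //; last 2 first.
  - exact: level_lt_trans ltV_trans.
  - exact: level_lt_total ltV_total.
  transitivity (\sum_(j < i) 1)%N; last by rewrite sum1_card card_ord.
  rewrite -sum1_card (big_ord_widen n (fun=> 1%N)); last exact: ltnW.
  apply: eq_bigl => j; rewrite !inE /lt /level_lt /=.
  by have [//|//|/val_inj ->] := ltngtP; rewrite ltV_irr.
rewrite /sorted_rep /sorted_tuple /= sz invg1.
have -> : map_of_perm 1%g = id_map n by apply/ffunP=> i; rewrite !ffunE perm1.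
rewrite (subst_id A_laws) -propeqE; congr (k _ _).
by apply/funext=> i; rewrite perm1.
Qed.

End Sorted.

(** * Representability *)

Lemma polyadic_representation n (A : polyadic_type_algebra n) :
  1 < n -> Rdf (df_reduct A) -> substitution_laws A -> A ->
  forall (U : Type) (h : A -> set ('I_n -> U)),
  @homomorphism _ (df_reduct A) (full_df_set_algebra n U) h ->
  exists (W : Type) (k : A -> set ('I_n -> W)),
    @homomorphism _ A (full_polyadic_set_algebra n W) k /\
    forall u, exists s, forall x, k x s <-> h x u.
Proof.
move=> n_gt1 A_Rdf A_laws x0 U h h_hom.
have [V [k [k_hom k_sing k_sep]]] := singular_representation A_Rdf A_laws h_hom x0.
have [lt [lt_irr lt_trans lt_total]] := strict_total_order_exists V.
exists (V * nat)%type, (sorted_rep k lt_irr); split.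
  exact: sorted_rep_hom.
move=> u; have [s sP] := k_sep u.
by exists (fun i => (s i, i : nat)) => x; rewrite sorted_rep_separates.
Qed.

Lemma Rdf_laws_RPA n (A : polyadic_type_algebra n) :
  1 < n -> Rdf (df_reduct A) -> substitution_laws A -> RPA A.
Proof.
move=> n_gt1 A_Rdf A_laws.
(* an empty carrier has no unit element, and embeds into the empty product *)
have [[x0]|A_empty] := pselect (inhabited A); last first.
  exists False, (fun=> unit); apply/isomorphic_to_subalgebraP.
  exists (fun x => False_rect _ (A_empty (inhabits x))).
  by split=> [x|]; [|split=> [x|x|? x]]; case: (A_empty (inhabits x)).
have [I [U /isomorphic_to_subalgebraP [h [h_inj [hD hN hU]]]]] := A_Rdf.
have ha a : @homomorphism _ (df_reduct A) (full_df_set_algebra n (U a)) (h ^~ a).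
  by split=> [x y|x|G x]; rewrite ?hD ?hN ?hU.
have rep a := cid (polyadic_representation n_gt1 A_Rdf A_laws x0 (ha a)).
pose k a := projT1 (cid (projT2 (rep a))).
have kP a := projT2 (cid (projT2 (rep a))).
exists I, (fun a => projT1 (rep a)); apply/isomorphic_to_subalgebraP.
exists (fun x a => k a x); split.
  move=> x y exy; apply: h_inj; apply: functional_extensionality_dep => a.
  have e : k a x = k a y := congr1 (fun f => f a) exy.
  have sep u : exists s, forall z, k a z s <-> h z a u := (kP a).2 u.
  by apply/seteqP; split=> u; have [s sP] := sep u; rewrite -!sP e.
by split=> [x y|x|j x]; apply: functional_extensionality_dep => a;
  have [[kD kN kU] _] := kP a; [exact: kD|exact: kN|exact: kU].
Qed.

Theorem theorem1p1 (n : nat) (hn : (3 <= n)%N) (A : polyadic_type_algebra n) :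
  RPA A <->
  (Rdf (df_reduct A) /\
   (forall (sigma : {ffun 'I_n -> 'I_n}) (x y : A),
      subst_op sigma (plus x y) = plus (subst_op sigma x) (subst_op sigma y)) /\
   (forall (sigma : {ffun 'I_n -> 'I_n}) (x : A),
      subst_op sigma (minus x) = minus (subst_op sigma x)) /\
   (forall (sigma tau : {ffun 'I_n -> 'I_n}) (x : A),
      subst_op (comp_map sigma tau) x = subst_op sigma (subst_op tau x)) /\
   (forall x : A, subst_op (id_map n) x = x) /\
   (forall (G : {set 'I_n}) (sigma tau : {ffun 'I_n -> 'I_n}) (x : A),
      (forall i : 'I_n, i \notin G -> sigma i = tau i) ->
      subst_op sigma (cyl_op G x) = subst_op tau (cyl_op G x)) /\
   (forall (G : {set 'I_n}) (sigma : {ffun 'I_n -> 'I_n}) (x : A),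
      {in sigma @^-1: G &, injective sigma} ->
      cyl_op G (subst_op sigma x) = subst_op sigma (cyl_op (sigma @^-1: G) x))).
Proof.
split=> [/RPA_laws [A_Rdf []]|]; first by [].
case=> A_Rdf [lD [lN [lC [l1 [lE lS]]]]].
by apply: Rdf_laws_RPA => //; apply: ltnW.
Qed.
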